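(* Let $\phi:\mathbb X\to[1,+\infty)$ be a Borel function such that $X$ admits an exponential $\phi$-coupling with exponent $\beta>0$; let $\pi$ be the unique invariant probability measure of $X$ and assume $\phi\in L_1(\mathbb X,\pi)$. Consider the semigroup $\{T_t\}$ generated by $X$ in $L_2=L_2(\mathbb X,\pi)$, and assume that $X$ is time reversible, or, equivalently, $T_t=T_t^*$ for all $t\ge 0$. Then $X$ satisfies $PI\left(\frac{\beta}{2}\right)$.
   Context: $(\mathbb X,\rho)$ is a locally compact metric space and $X=(X_t)_{t\ge0}$ is a time-homogeneous, stochastically continuous, strong Markov process in $\mathbb X$ with càdlàg trajectories and transition function $P_t(x,dy)$. A probability measure $\pi$ is invariant for $X$ if $\int_{\mathbb X}P_t(x,\cdot)\,\pi(dx)=\pi$ for all $t\ge0$. Coupling: for probability measures $\mu,\nu$ on $\mathbb X$, a $(\mu,\nu)$-coupling for $X$ is any two-component process $Z=(Z^1,Z^2)$ such that $Z^1$ has the law of $X$ with initial distribution $\mu$ and $Z^2$ has the law of $X$ with initial distribution $\nu$. For a Borel function $\phi:\mathbb X\to[1,+\infty)$, $X$ admits an exponential $\phi$-coupling (with constants $C_\phi>0$, $\beta>0$; $\beta$ is the exponent) if there is an invariant probability measure $\pi$ such that for every $x\in\mathbb X$ there is a $(\delta_x,\pi)$-coupling $Z=(Z^1,Z^2)$ with $E\big[(\phi(Z^1_t)+\phi(Z^2_t))\mathbf 1_{Z^1_t\ne Z^2_t}\big]\le C_\phi e^{-\beta t}\phi(x)$ for all $t\ge0$. $T_tf(x)=\int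 f(y)P_t(x,dy)$; $L_2$ is the complex space $L_2^{\mathbb C}(\mathbb X,\pi)$ and $L_2^0=\{f\in L_2:\int f\,d\pi=0\}$. Time reversibility means that the stationary version of $X$ (with initial law $\pi$) run backward in time has the same distribution as $X$, i.e. the dual process $X^*$ has the same distribution as $X$. For $\gamma>0$, $X$ satisfies $PI(\gamma)$ if $\|T_tf\|_2\le e^{-\gamma t}\|f\|_2$ for all $t\ge0$, $f\in L_2^0$ (equivalently, the Poincaré inequality holds with constant $c=\gamma^{-1}$). *)

(* Defs.v *)
From HB Require Import structures.
From mathcomp Require Import all_boot all_order all_algebra.
From mathcomp Require Import complex.
From mathcomp Require Import all_classical all_reals all_analysis.

Set Implicit Arguments.
Unset Strict Implicit.
Unset Printing Implicit Defensive.

Import Order.TTheory GRing.Theory Num.Theory.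
Import numFieldNormedType.Exports.

Local Open Scope classical_set_scope.
Local Open Scope ring_scope.

(* Measurable spaces are pointed in MathComp-Analysis; a space that carries a
   probability measure is nonempty, so the base point loses no generality. *)
#[short(type="pmetricType")]
HB.structure Definition PMetric (K : numDomainType) :=
  { M of Metric K M & isPointed M }.

Notation borel E := (g_sigma_algebraType (@open E)).

Section Paths.
Context (R : realType) (E : pmetricType R).

(* The product sigma-algebra on paths observed at the times in [I] only;
   all time sets used below are contained in [0, +oo), so the values of a path
   [R -> E] at negative times are never seen. *)
Definition path_events (I : set R) : set (set (R -> E)) :=
  <<s [set C | exists t (B : set (borel E)),
         [/\ I t, measurable B & C = [set f | B (f t)]]] >>.

End Paths.

Section MarkovProcess.
Context (R : realType) (E : pmetricType R).
Context (d : measure_display) (Omega : measurableType d).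
(* [X t] is the position at time [t >= 0]; [P x] is the law on [Omega] under
   which the process starts from [x]. *)
Variables (X : R -> {mfun Omega >-> borel E}) (P : R.-pker (borel E) ~> Omega).

Definition transition (t : R) (x : borel E) : set (borel E) -> \bar R :=
  pushforward (P x) (X t).

Section TransitionMeasure.
Variables (t : R) (x : borel E).

Let transition0 : transition t x set0 = 0%E.
Proof. by rewrite /transition /pushforward preimage_set0 measure0. Qed.

Let transition_ge0 B : (0 <= transition t x B)%E.
Proof. exact: measure_ge0. Qed.

Let transition_sigma_additive : semi_sigma_additive (transition t x).
Proof.
exact: (@measure_semi_sigma_additive _ _ _
  (measure_function_pushforward__canonical__measure_function_Measure
     (P x) (measurable_funPT (X t)))).
Qed.

HB.instance Definition _ := isMeasure.Build _ _ _ (transition t x)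
  transition0 transition_ge0 transition_sigma_additive.

Let transition_setT : transition t x [set: borel E] = 1%E.
Proof. by rewrite /transition /pushforward preimage_setT prob_kernel. Qed.

HB.instance Definition _ := Measure_isProbability.Build _ _ _
  (transition t x) transition_setT.

End TransitionMeasure.

Definition history (t : R) : set (set Omega) :=
  <<s [set C | exists s (B : set (borel E)),
         [/\ 0 <= s, s <= t, measurable B & C = X s @^-1` B]] >>.

Definition stopping_time (tau : Omega -> \bar R) : Prop :=
  (forall w, (0 <= tau w)%E) /\
  (forall t, 0 <= t -> history t [set w | (tau w <= t%:E)%E]).

Definition before_stopping (tau : Omega -> \bar R) (A : set Omega) : Prop :=
  measurable A /\
  (forall t, 0 <= t -> history t (A `&` [set w | (tau w <= t%:E)%E])).

(* P_x(X_(tau+t) \in B | F_tau) = P_t(X_tau, B) a.s. on {tau < oo}, with the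
   conditional expectation written out on the events [A] of F_tau. *)
Definition strong_markov_property : Prop :=
  forall (x : borel E) (tau : Omega -> \bar R), stopping_time tau ->
  forall A, before_stopping tau A ->
  forall (t : R) (B : set (borel E)), 0 <= t -> measurable B ->
    let fin := [set w | (tau w < +oo)%E] in
    P x (A `&` fin `&` [set w | B (X (fine (tau w) + t) w)]) =
    (\int[P x]_(w in A `&` fin) transition t (X (fine (tau w)) w) B)%E.

Definition cadlag_trajectories : Prop :=
  forall w (t : R), 0 <= t ->
    (X s w : E) @[s --> t^'+] --> (X t w : E) /\
    (0 < t -> exists l : E, (X s w : E) @[s --> t^'-] --> l).

(* [E] need not be separable, so {rho(X_s, X_t) > e} need not be measurable a
   priori: its probability is read as the outer one, which agrees with [P x]
   on measurable sets. *)
Definition stochastically_continuous : Prop :=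
  forall (x : borel E) (t e : R), 0 <= t -> 0 < e ->
    mu_ext (P x) [set w | e < mdist (X s w : E) (X t w : E)]
      @[s --> within [set s | 0 <= s] (nbhs t)] --> (0 : \bar R).

Record strong_markov_process : Prop := {
  smp_start : forall x : borel E, P x (X 0 @^-1` [set x]) = 1%E;
  smp_cadlag : cadlag_trajectories;
  smp_continuous : stochastically_continuous;
  smp_markov : strong_markov_property }.

Definition invariant_measure (pi : probability (borel E) R) : Prop :=
  forall (t : R) (B : set (borel E)), 0 <= t -> measurable B ->
    (\int[pi]_x transition t x B)%E = pi B.

Definition has_law_from (mu : {measure set (borel E) -> \bar R})
    (d' : measure_display) (Omega' : measurableType d')
    (P' : probability Omega' R) (Z : R -> {mfun Omega' >-> borel E}) : Prop :=
  forall A : set (R -> E), path_events [set t | 0 <= t] A ->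
    P' [set w | A (fun t => Z t w)] =
    (\int[mu]_x P x [set w | A (fun t => X t w)])%E.

Definition is_coupling (mu nu : {measure set (borel E) -> \bar R})
    (d' : measure_display) (Omega' : measurableType d')
    (P' : probability Omega' R) (Z1 Z2 : R -> {mfun Omega' >-> borel E}) : Prop :=
  has_law_from mu P' Z1 /\ has_law_from nu P' Z2.

(* When the diagonal of [E * E] is not measurable the integrand below need not
   be measurable, and the library integral of this nonnegative function is then
   its lower integral. *)
Definition exponential_coupling (phi : borel E -> R) (beta : R) : Prop :=
  0 < beta /\
  exists (C : R) (pi : probability (borel E) R),
    [/\ 0 < C, invariant_measure pi &
     forall x : borel E,
     exists (d' : measure_display) (Omega' : measurableType d')
       (P' : probability Omega' R) (Z1 Z2 : R -> {mfun Omega' >-> borel E}),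
       is_coupling (dirac x) pi P' Z1 Z2 /\
       forall t, 0 <= t ->
         (\int[P']_w ((phi (Z1 t w) + phi (Z2 t w)) *
                      \1_[set w | Z1 t w <> Z2 t w] w)%:E
          <= (C * expR (- beta * t) * phi x)%:E)%E].

(* On each bounded time window [0, T] the stationary process read backwards has
   the same law as the stationary process. *)
Definition time_reversible (pi : probability (borel E) R) : Prop :=
  forall (T : R) (A : set (R -> E)), 0 <= T ->
    path_events [set t | 0 <= t <= T] A ->
    (\int[pi]_x P x [set w | A (fun t => X (T - t) w)])%E =
    (\int[pi]_x P x [set w | A (fun t => X t w)])%E.

End MarkovProcess.

Section ComplexL2.
Context (R : realType) (d : measure_display) (T : measurableType d).

Definition cintegral (mu : {measure set T -> \bar R}) (f : T -> R[i]) : R[i] :=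
  Complex (\int[mu]_x complex.Re (f x)) (\int[mu]_x complex.Im (f x)).

Definition cmeasurable (f : T -> R[i]) : Prop :=
  measurable_fun setT (fun x => complex.Re (f x)) /\
  measurable_fun setT (fun x => complex.Im (f x)).

Definition norm2 (mu : {measure set T -> \bar R}) (f : T -> R[i]) : \bar R :=
  (Lnorm mu 2%:E (fun x => (ComplexField.Normc.normc (f x))%:E))%E.

(* Elements of L_2 are represented by functions, not by classes modulo
   [mu]-almost everywhere equality. *)
Definition L2 (mu : {measure set T -> \bar R}) (f : T -> R[i]) : Prop :=
  cmeasurable f /\ (norm2 mu f < +oo)%E.

Definition L2_centered (mu : {measure set T -> \bar R}) (f : T -> R[i]) : Prop :=
  L2 mu f /\ cintegral mu f = 0.

Definition inner2 (mu : {measure set T -> \bar R}) (f g : T -> R[i]) : R[i] :=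
  cintegral mu (fun x => f x * (g x)^*%C).

End ComplexL2.

Section Semigroup.
Context (R : realType) (E : pmetricType R).
Context (d : measure_display) (Omega : measurableType d).
Variables (X : R -> {mfun Omega >-> borel E}) (P : R.-pker (borel E) ~> Omega).

(* For f in L_2(pi) with pi invariant, f is P_t(x,.)-integrable for pi-almost
   every x; at the remaining points the value is immaterial. *)
Definition semigroup (t : R) (f : borel E -> R[i]) (x : borel E) : R[i] :=
  cintegral (transition X P t x) f.

Definition self_adjoint_semigroup (pi : probability (borel E) R) : Prop :=
  forall (t : R) (f g : borel E -> R[i]), 0 <= t -> L2 pi f -> L2 pi g ->
    inner2 pi (semigroup t f) g = inner2 pi f (semigroup t g).

Definition PI (pi : probability (borel E) R) (gamma : R) : Prop :=
  forall (t : R) (f : borel E -> R[i]), 0 <= t -> L2_centered pi f ->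
    (norm2 pi (semigroup t f) <= (expR (- gamma * t))%:E * norm2 pi f)%E.

End Semigroup.

(* Main.v *)
(* Write a(t) for the squared L_2-norm of T_t u, with u bounded, real and
   centered. The coupling gives |T_t u(x) - c| <= M C exp(- beta t) phi(x),
   where M bounds u and c is a constant; as phi is integrable,
   a(t) = O(exp(- beta t)), with a constant depending on u. Self-adjointness and
   the semigroup property give a(t) = <u, T_2t u>, so Cauchy-Schwarz yields
   a(t)^2 <= a(0) a(2t). Iterating this along t, 2t, 4t, ... removes the
   constant: a(t) <= a(0) exp(- beta t). Truncation and Fatou's lemma extend the
   bound to L_2, and a complex f is split into its real and imaginary parts. *)
Require Import Defs.
From HB Require Import structures.
From mathcomp Require Import all_boot all_order all_algebra.
From mathcomp Require Import complex.
From mathcomp Require Import all_classical all_reals all_analysis.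
From mathcomp Require Import measurable_realfun giry ring lra.

Set Implicit Arguments.
Unset Strict Implicit.
Unset Printing Implicit Defensive.

Import Order.TTheory GRing.Theory Num.Theory.
Import numFieldNormedType.Exports.

Local Open Scope classical_set_scope.
Local Open Scope ring_scope.

(** * Mixtures and reversible kernels *)

Section Mixture.
Local Open Scope ereal_scope.
Context d1 d2 (T1 : measurableType d1) (T2 : measurableType d2) (R : realType).

(** The second hypothesis says that [nu] is the bind of [mu] with [k] in the Giry monad, so this is
    the integration formula for a bind. *)
Lemma ge0_integral_mixture (mu : probability T1 R) (nu : probability T2 R)
    (k : T1 -> probability T2 R) (f : T2 -> \bar R) :
  (forall B, measurable B -> measurable_fun [set: _] (k ^~ B)) ->
  (forall B, measurable B -> nu B = \int[mu]_x k x B) ->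
  measurable_fun setT f -> (forall y, 0 <= f y) ->
  \int[nu]_y f y = \int[mu]_x \int[k x]_y f y.
Proof.
move=> mk nuE mf f0.
pose k' : T1 -> giry T2 R := fun x => k x.
have mk' : measurable_fun setT k' by exact: measurable_giry_codensity.
have := giry_int_bind (mu : giry T1 R) mk' mf f0.
rewrite /giry_int => <-.
apply: eq_measure_integral => B mB _.
rewrite -[LHS]/(nu B) nuE// /giry_bind/= /giry_join/=.
rewrite [RHS]giry_int_map//; exact: measurable_giry_ev.
Qed.
End Mixture.

Section Reversible.
Local Open Scope ereal_scope.
Context d (T : measurableType d) (R : realType).

(* The joint law of a point drawn from [mu] and its successor under [k] is
   invariant under swapping on rectangles, hence everywhere. *)
Lemma ge0_integral_reversible (mu : probability T R) (k : T -> probability T R)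
    (f g : T -> \bar R) :
  (forall B, measurable B -> measurable_fun [set: _] (k ^~ B)) ->
  (forall A B, measurable A -> measurable B ->
     \int[mu]_(x in A) k x B = \int[mu]_(x in B) k x A) ->
  measurable_fun setT f -> (forall y, 0 <= f y) ->
  measurable_fun setT g -> (forall y, 0 <= g y) ->
  \int[mu]_x (f x * \int[k x]_y g y) = \int[mu]_x (g x * \int[k x]_y f y).
Proof.
move=> mk sym mf f0 mg g0.
pose k' : T -> giry T R := fun x => k x.
have mk' : measurable_fun setT k' by exact: measurable_giry_codensity.
(* [j x] is the law of the pair of [x] and its successor, as the product of the Dirac mass at [x]
   with [k x]; averaging over [mu] gives the joint law [m]. *)
pose j : T -> giry (T * T)%type R := fun x => giry_prod (giry_ret x, k' x).
have mj : measurable_fun setT j.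
  apply: measurableT_comp; first exact: measurable_giry_prod.
  by apply/measurable_fun_pairP; split => //; exact: measurable_giry_ret.
pose m := giry_bind (mu : giry T R) mj.
have intm (F : T * T -> \bar R) : measurable_fun setT F ->
    (forall z, 0 <= F z) -> \int[m]_z F z = \int[mu]_x \int[k x]_y F (x, y).
  move=> mF F0; rewrite [LHS]giry_int_bind//.
  apply: eq_integral => x _; rewrite [LHS]giry_int_prod1// giry_int_ret//.
  by apply: measurable_fun_fubini_tonelli_F.
have mE A B : measurable A -> measurable B ->
    m (A `*` B) = \int[mu]_(x in A) k x B.
  move=> mA mB.
  have mAB : measurable (A `*` B) by exact: measurableX.
  transitivity (\int[m]_z (\1_(A `*` B) z)%:E).
    by rewrite integral_indic// setIT.
  rewrite intm; last 2 first.
  - by apply/measurable_EFinP; exact: measurable_indic.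
  - by move=> z; rewrite lee_fin.
  rewrite [RHS]integral_mkcond; apply: eq_integral => x _.
  rewrite patchE; case: ifPn => xA.
    transitivity (\int[k x]_y (\1_B y)%:E).
      by apply: eq_integral => y _; rewrite !indicE in_setX xA.
    by rewrite integral_indic// setIT.
  by apply: integral0_eq => y _; rewrite indicE in_setX (negbTE xA).
have mswap : measurable_fun setT (@unstable.swap T T) by exact: measurable_swap.
pose m' : giry (T * T)%type R := giry_map mswap m.
(* Rectangles are stable under intersection and generate the product sigma-algebra, so two finite
   measures that agree on them are equal. *)
have mE' C : measurable C -> m C = m' C.
  move=> mC.
  apply: (@measure_unique _ R _
    [set A `*` B | A in measurable & B in measurable] (fun=> setT)
    _ _ _ _ m m') => //.
  - by rewrite measurable_prod_measurableType.
  - move=> _ _ [A1 mA1 [B1 mB1 <-]] [A2 mA2 [B2 mB2 <-]].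
    exists (A1 `&` A2); first exact: measurableI.
    by exists (B1 `&` B2); [exact: measurableI|rewrite setXI].
  - by move=> _; exists setT => //; exists setT => //; rewrite setXTT.
  - by apply/seteqP; split => // x _; exists 0%N.
  - move=> _ [A mA [B mB <-]].
    transitivity (m (B `*` A)).
      apply: etrans (mE _ _ mA mB) _.
      exact: etrans (sym _ _ mA mB) (esym (mE _ _ mB mA)).
    rewrite -[RHS]/(m _).
    by congr (m _); apply/seteqP; split => -[x y] /= [].
  - by move=> _; rewrite (@le_lt_trans _ _ 1) ?sprobability_setT ?ltry.
have mF (u v : T -> \bar R) : measurable_fun setT u -> measurable_fun setT v ->
    measurable_fun setT (fun z : T * T => u z.1 * v z.2).
  by move=> mu' mv; apply: emeasurable_funM; exact: measurableT_comp.
have intF (u v : T -> \bar R) :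
    measurable_fun setT u -> measurable_fun setT v -> (forall x, 0 <= u x) ->
    (forall x, 0 <= v x) ->
    \int[m]_z (u z.1 * v z.2) = \int[mu]_x (u x * \int[k x]_y v y).
  move=> mu' mv u0 v0; rewrite intm//; last 2 first.
  - exact: mF.
  - by move=> z; exact: mule_ge0.
  by apply: eq_integral => x _ /=; rewrite ge0_integralZl// => y _.
(* Both sides are now integrals against [m]; replacing [m] by its swap [m'] on the left exchanges
   the two coordinates. *)
rewrite -intF// -intF//.
rewrite (eq_measure_integral m'); last by move=> C mC _; exact: mE'.
rewrite [LHS]giry_int_map//; last 2 first.
- exact: mF.
- by move=> z; exact: mule_ge0.
by apply: eq_integral => -[x y] _ /=; rewrite muleC.
Qed.
End Reversible.

(** * Integrals of bounded measurable functions *)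

Section BoundedMeasurable.
Context d (T : measurableType d) (R : realType).
Implicit Types (f g : T -> R) (mu : probability T R).

(** Such functions are integrable against every probability measure, so their integrals can be
    handled in [R] without finiteness side conditions. *)
Definition bounded_measurable f : Prop :=
  measurable_fun setT f /\ exists M, forall x, `|f x| <= M.

Lemma bounded_measurable_cst c : bounded_measurable (fun=> c).
Proof. by split => //; exists `|c|. Qed.

Lemma bounded_measurableD f g : bounded_measurable f -> bounded_measurable g ->
  bounded_measurable (fun x => f x + g x).
Proof.
move=> [mf [M fM]] [mg [N gN]]; split; first exact: measurable_funD.
by exists (M + N) => x; rewrite (le_trans (ler_normD _ _))// lerD.
Qed.

Lemma bounded_measurableM f g : bounded_measurable f -> bounded_measurable g ->
  bounded_measurable (fun x => f x * g x).
Proof.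
move=> [mf [M fM]] [mg [N gN]]; split; first exact: measurable_funM.
by exists (M * N) => x; rewrite normrM ler_pM.
Qed.

Lemma bounded_measurableZ c f : bounded_measurable f ->
  bounded_measurable (fun x => c * f x).
Proof. exact/bounded_measurableM/bounded_measurable_cst. Qed.

Lemma bounded_measurableB f g : bounded_measurable f -> bounded_measurable g ->
  bounded_measurable (fun x => f x - g x).
Proof.
move=> bf bg.
rewrite (_ : (fun x => _) = (fun x => f x + (- 1) * g x)); last first.
  by apply/funext => x; rewrite mulN1r.
exact/bounded_measurableD/bounded_measurableZ.
Qed.

Lemma bounded_measurable_sqr f : bounded_measurable f ->
  bounded_measurable (fun x => f x ^+ 2).
Proof.
by move=> bf; under eq_fun do rewrite expr2; exact: bounded_measurableM.
Qed.

Lemma bounded_measurable_norm f : bounded_measurable f ->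
  bounded_measurable (fun x => `|f x|).
Proof.
move=> [mf [M fM]]; split; first exact: measurableT_comp.
by exists M => x; rewrite normr_id.
Qed.

(** Adding a constant brings signed functions within reach of the formulas for nonnegative ones. *)
Lemma bounded_measurable_shift f : bounded_measurable f ->
  exists2 M, 0 <= M & forall x, 0 <= f x + M.
Proof.
move=> [_ [M fM]]; exists M => [|x]; first exact: le_trans (fM point).
by rewrite -lerBlDr sub0r; have := fM x; rewrite ler_norml => /andP[].
Qed.

Lemma bounded_measurable_integrable mu f : bounded_measurable f ->
  mu.-integrable setT (EFin \o f).
Proof.
move=> [mf [M fM]]; apply: measurable_bounded_integrable => //.
  exact: le_lt_trans (probability_le1 mu measurableT) (ltry 1).
exists M; split; first exact: num_real.
by move=> y My x _; exact/(le_trans (fM x))/ltW.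
Qed.

Lemma EFin_Rintegral mu f : bounded_measurable f ->
  (\int[mu]_x f x)%:E = (\int[mu]_x (f x)%:E)%E.
Proof.
move=> bf; rewrite fineK//.
exact: integrable_fin_num (bounded_measurable_integrable mu bf).
Qed.

Lemma probability_Rintegral_cst mu c : \int[mu]_x c = c.
Proof. by rewrite Rintegral_cst// [X in fine X]probability_setT mulr1. Qed.

Lemma bounded_RintegralD mu f g :
  bounded_measurable f -> bounded_measurable g ->
  \int[mu]_x (f x + g x) = \int[mu]_x f x + \int[mu]_x g x.
Proof.
by move=> bf bg; rewrite RintegralD//; exact: bounded_measurable_integrable.
Qed.

Lemma bounded_RintegralB mu f g :
  bounded_measurable f -> bounded_measurable g ->
  \int[mu]_x (f x - g x) = \int[mu]_x f x - \int[mu]_x g x.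
Proof.
by move=> bf bg; rewrite RintegralB//; exact: bounded_measurable_integrable.
Qed.

Lemma bounded_RintegralZ mu c f : bounded_measurable f ->
  \int[mu]_x (c * f x) = c * \int[mu]_x f x.
Proof.
by move=> bf; rewrite RintegralZl//; exact: bounded_measurable_integrable.
Qed.

Lemma bounded_le_Rintegral mu f g :
  bounded_measurable f -> bounded_measurable g ->
  (forall x, f x <= g x) -> \int[mu]_x f x <= \int[mu]_x g x.
Proof.
move=> bf bg fg.
by apply: le_Rintegral => //; exact: bounded_measurable_integrable.
Qed.

Lemma bounded_normr_Rintegral mu f M : measurable_fun setT f ->
  (forall x, `|f x| <= M) -> `|\int[mu]_x f x| <= M.
Proof.
move=> mf fM; have bf : bounded_measurable f by split => //; exists M.
have ibf := bounded_measurable_integrable mu bf.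
apply: le_trans (le_normr_Rintegral _ ibf) _ => //.
rewrite -[leRHS](probability_Rintegral_cst mu).
apply: bounded_le_Rintegral => //; last exact: bounded_measurable_cst.
exact: bounded_measurable_norm.
Qed.

Lemma bounded_cauchy_schwarz mu f g :
  bounded_measurable f -> bounded_measurable g ->
  (\int[mu]_x (f x * g x)) ^+ 2 <=
  (\int[mu]_x (f x ^+ 2)) * \int[mu]_x (g x ^+ 2).
Proof.
move=> bf bg; set B := \int[mu]_x (f x * g x).
set A := \int[mu]_x (f x ^+ 2); set C := \int[mu]_x (g x ^+ 2).
have bf2 := bounded_measurable_sqr bf; have bg2 := bounded_measurable_sqr bg.
have bfg := bounded_measurableM bf bg.
(* The polynomial in [l] is the integral of [(f - l * g) ^+ 2]. *)
have q l : 0 <= A + (- 2 * l * B + l ^+ 2 * C).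
  have bB := bounded_measurableZ (- 2 * l) bfg.
  have bC := bounded_measurableZ (l ^+ 2) bg2.
  have bBC := bounded_measurableD bB bC.
  rewrite /A /B /C -!bounded_RintegralZ// -!bounded_RintegralD//.
  apply: Rintegral_ge0 => x _.
  have -> : f x ^+ 2 + (- 2 * l * (f x * g x) + l ^+ 2 * g x ^+ 2) =
            (f x - l * g x) ^+ 2.
    by ring.
  exact: sqr_ge0.
have C0 : 0 <= C by apply: Rintegral_ge0 => x _; exact: sqr_ge0.
have [C0'|Cpos] := eqVneq C 0.
  (* For [C = 0] the polynomial is affine in [l]; if [B] were nonzero, its value at this [l] would
     be [-1]. *)
  rewrite C0' mulr0; have := q ((A + 1) / (2 * B)); rewrite C0' mulr0 addr0.
  have [->|B0] := eqVneq B 0; first by rewrite expr0n.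
  have -> : - 2 * ((A + 1) / (2 * B)) * B = - (A + 1) by field.
  by rewrite opprD addrA subrr sub0r oppr_ge0 ler10.
have {}Cpos : 0 < C by rewrite lt_neqAle eq_sym Cpos.
(* [B / C] minimizes the polynomial, and [C] times the minimum is [A * C - B ^+ 2]. *)
have := q (B / C); rewrite -(pmulr_rge0 _ Cpos).
have -> : C * (A + (- 2 * (B / C) * B + (B / C) ^+ 2 * C)) = A * C - B ^+ 2.
  by field; rewrite gt_eqF.
by rewrite subr_ge0.
Qed.

End BoundedMeasurable.

(** * Kernels acting on bounded functions *)

Section BoundedMixture.
Context d1 d2 (T1 : measurableType d1) (T2 : measurableType d2) (R : realType).
Variables (k : T1 -> probability T2 R).
Hypothesis mk : forall B, measurable B -> measurable_fun [set: T1] (k ^~ B).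

(** No bound on [f] is assumed, since this also serves for L_2 functions: the integrals of the
    positive and negative parts are measurable in [x], and [fine] gives a default value where the
    integral is infinite. *)
Lemma measurable_Rintegral_kernel f : measurable_fun setT f ->
  measurable_fun setT (fun x => \int[k x]_y f y).
Proof.
move=> mf; apply: measurableT_comp => //.
have mf' : measurable_fun setT (EFin \o f) by exact/measurable_EFinP.
under eq_fun do rewrite integralE.
apply: emeasurable_funB; apply: measurable_fun_integral_kernel => //.
- exact: measurable_funepos.
- exact: measurable_funeneg.
Qed.

Lemma bounded_measurable_kernel f : bounded_measurable f ->
  bounded_measurable (fun x => \int[k x]_y f y).
Proof.
move=> [mf [M fM]]; split; first exact: measurable_Rintegral_kernel.
by exists M => x; exact: bounded_normr_Rintegral.
Qed.

(** The shift [f + M] is nonnegative, and [M] cancels because all the measures have mass one. *)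
Lemma bounded_integral_mixture (mu : probability T1 R) (nu : probability T2 R)
    f :
  (forall B, measurable B -> nu B = \int[mu]_x k x B)%E ->
  bounded_measurable f ->
  \int[nu]_y f y = \int[mu]_x \int[k x]_y f y.
Proof.
move=> nuE bf; have [M M0 fM] := bounded_measurable_shift bf.
have bM d (T : measurableType d) := @bounded_measurable_cst _ T R M.
have bfM := bounded_measurableD bf (bM _ _).
have bkf := bounded_measurable_kernel bf.
apply: (addIr M); apply: EFin_inj.
rewrite -[in LHS](probability_Rintegral_cst nu M) -bounded_RintegralD//.
rewrite -[in RHS](probability_Rintegral_cst mu M) -bounded_RintegralD//.
rewrite !EFin_Rintegral//; last exact: bounded_measurableD.
rewrite (ge0_integral_mixture mk nuE)//; last first.
  by apply/measurable_EFinP; case: bfM.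
apply: eq_integral => x _.
by rewrite -EFin_Rintegral// bounded_RintegralD// probability_Rintegral_cst.
Qed.

End BoundedMixture.

Section BoundedReversible.
Context d (T : measurableType d) (R : realType).
Variables (mu : probability T R) (k : T -> probability T R).
Hypothesis mk : forall B, measurable B -> measurable_fun [set: T] (k ^~ B).
Hypothesis rev : forall A B, measurable A -> measurable B ->
  (\int[mu]_(x in A) k x B = \int[mu]_(x in B) k x A)%E.

(** Detailed balance between [B] and the whole space. *)
Lemma reversible_invariant B : measurable B -> (mu B = \int[mu]_x k x B)%E.
Proof.
move=> mB; rewrite rev//.
under eq_integral do rewrite probability_setT.
by rewrite integral_cst// mul1e.
Qed.

Lemma bounded_integral_reversible f g :
  bounded_measurable f -> bounded_measurable g ->
  \int[mu]_x (f x * \int[k x]_y g y) = \int[mu]_x (g x * \int[k x]_y f y).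
Proof.
move=> bf bg.
have [M M0 fM] := bounded_measurable_shift bf.
have [N N0 gN] := bounded_measurable_shift bg.
have bc c := @bounded_measurable_cst _ T R c.
have bfM := bounded_measurableD bf (bc M).
have bgN := bounded_measurableD bg (bc N).
(* By invariance the mean of the kernel integral of [v] is the mean of [v]. The terms created by the
   shifts are then symmetric in [(u, a)] and [(v, b)], so they cancel in the comparison. *)
have expand u v (a b : R) : bounded_measurable u -> bounded_measurable v ->
    (\int[mu]_x ((u x + a)%:E * \int[k x]_y (v y + b)%:E))%E =
    (\int[mu]_x (u x * \int[k x]_y v y) + b * \int[mu]_x u x +
      (a * \int[mu]_x v x + a * b))%:E.
  move=> bu bv.
  have bkv := bounded_measurable_kernel mk bv.
  rewrite (bounded_integral_mixture mk reversible_invariant bv).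
  rewrite -[a * b](probability_Rintegral_cst mu) -!bounded_RintegralZ//.
  have ? := bounded_measurableZ a bkv; have ? := bounded_measurableZ b bu.
  have ? := bounded_measurableM bu bkv.
  have ? := bc (a * b).
  do 3 (rewrite -bounded_RintegralD//; try exact: bounded_measurableD).
  rewrite EFin_Rintegral; last by do 2 apply: bounded_measurableD => //.
  apply: eq_integral => x _.
  rewrite -EFin_Rintegral; last exact: bounded_measurableD.
  rewrite bounded_RintegralD// probability_Rintegral_cst -EFinM; congr EFin.
  ring.
have := ge0_integral_reversible mk rev
  (f := fun x => (f x + M)%:E) (g := fun x => (g x + N)%:E).
rewrite !expand// => e.
have {}e := EFin_inj (e ((measurable_EFinP _ _).2 bfM.1) fM
  ((measurable_EFinP _ _).2 bgN.1) gN).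
move: e; lra.
Qed.

End BoundedReversible.

(** * Exponential decay from a doubling inequality *)

Lemma ler_bernoulli (R : realType) (x : R) n : 0 <= x ->
  1 + n%:R * x <= (1 + x) ^+ n.
Proof.
move=> x0; elim: n => [|n IH]; first by rewrite mul0r addr0 expr0.
rewrite exprS; apply: le_trans (ler_wpM2l _ IH); last lra.
have : 0 <= n%:R * x * x by rewrite !mulr_ge0.
by rewrite -natr1; lra.
Qed.

(* If b(s) = a(s) exp(beta s) / a0, then b(t)^(2^n) <= b(2^n t) stays bounded,
   so b(t) <= 1. *)
Lemma doubling_decay (R : realType) (a : R -> R) (a0 D beta t : R) :
  0 <= a0 -> (forall s, 0 <= s -> 0 <= a s) ->
  (forall s, 0 <= s -> a s ^+ 2 <= a0 * a (s + s)) ->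
  (forall s, 0 <= s -> a s <= D * expR (- beta * s)) ->
  0 <= t -> a t <= a0 * expR (- beta * t).
Proof.
move=> a00 a_ge0 a_sqr a_le t0.
(* The normalization divides by [a0]; when [a0 = 0] the doubling inequality alone forces
   [a t = 0]. *)
have [a0E|a0N] := eqVneq a0 0.
  have := a_sqr _ t0; rewrite a0E !mul0r => h.
  by rewrite -(@ler_pXn2r _ 2) ?nnegrE ?a_ge0// expr0n.
have {a0N}a0P : 0 < a0 by rewrite lt_neqAle eq_sym a0N.
pose b s := a s * expR (beta * s) / a0.
have b_ge0 s : 0 <= s -> 0 <= b s.
  by move=> s0; rewrite divr_ge0// mulr_ge0 ?a_ge0 ?expR_ge0.
have b_sqr s : 0 <= s -> b s ^+ 2 <= b (s + s).
  move=> s0; rewrite /b mulrDr expRD.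
  have -> : (a s * expR (beta * s) / a0) ^+ 2 =
      a s ^+ 2 * (expR (beta * s) * expR (beta * s) / a0 ^+ 2).
    by field; rewrite gt_eqF.
  have -> : a (s + s) * (expR (beta * s) * expR (beta * s)) / a0 =
      (a0 * a (s + s)) * (expR (beta * s) * expR (beta * s) / a0 ^+ 2).
    by field; rewrite gt_eqF.
  by rewrite ler_wpM2r ?a_sqr// divr_ge0 ?sqr_ge0// mulr_ge0 ?expR_ge0.
have b_le s : 0 <= s -> b s <= D / a0.
  move=> s0; rewrite ler_pM2r ?invr_gt0//.
  apply: le_trans (ler_wpM2r (expR_ge0 _) (a_le _ s0)) _.
  by rewrite -mulrA -expRD mulNr addNr expR0 mulr1.
have b_pow n : b t ^+ (2 ^ n) <= b (2 ^+ n * t).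
  elim: n => [|n IH]; first by rewrite expr1 expr0 mul1r.
  rewrite expnSr exprM [2 ^+ n.+1]exprS.
  have -> : 2 * 2 ^+ n * t = 2 ^+ n * t + 2 ^+ n * t by ring.
  have nt0 : 0 <= 2 ^+ n * t by rewrite mulr_ge0// exprn_ge0.
  apply: le_trans _ (b_sqr _ nt0).
  by rewrite ler_pXn2r// nnegrE ?b_ge0// exprn_ge0// b_ge0.
have b_le1 : b t <= 1.
  rewrite leNgt; apply/negP => b_gt1.
  have c0 : 0 < b t - 1 by rewrite subr_gt0.
  have D0 : 0 <= D / a0 by exact: le_trans (b_ge0 _ t0) (b_le _ t0).
  (* This [n] satisfies [D / a0 < n * (b t - 1)], whereas Bernoulli and [n <= 2 ^ n] give [n * (b t
     - 1) <= b t ^+ (2 ^ n) <= D / a0]. *)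
  have := archi_boundP (divr_ge0 D0 (ltW c0)); set n := Num.bound _.
  rewrite ltr_pdivrMr// => Dn.
  have := le_lt_trans (le_trans (b_pow n) (b_le _ _)) Dn.
  rewrite mulr_ge0 ?exprn_ge0// => /(_ isT); apply/negP; rewrite -leNgt.
  have := ler_bernoulli (2 ^ n) (ltW c0); rewrite subrKC; apply: le_trans.
  rewrite -[leLHS]add0r lerD// ler_wpM2r ?(ltW c0)// ler_nat.
  exact/ltnW/ltn_expl.
move: b_le1; rewrite /b ler_pdivrMr// mul1r => h.
by rewrite mulNr expRN ler_pdivlMr ?expR_gt0.
Qed.

(** * Decay of the energy along a reversible semigroup *)

Section ReversibleSemigroup.
Context d (T : measurableType d) (R : realType).
Variables (mu : probability T R) (K : R -> T -> probability T R).
Hypothesis mK : forall t B, measurable B -> measurable_fun [set: T] (K t ^~ B).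
Hypothesis chapman : forall (s t : R) x B, 0 <= s -> 0 <= t -> measurable B ->
  (K (s + t) x B = \int[K s x]_y K t y B)%E.
Hypothesis rev : forall (t : R) A B, 0 <= t -> measurable A -> measurable B ->
  (\int[mu]_(x in A) K t x B = \int[mu]_(x in B) K t x A)%E.
Variables (phi : T -> R) (C beta : R).
Hypothesis C_ge0 : 0 <= C.
Hypothesis phi_int : mu.-integrable setT (EFin \o phi).
(** This is what the coupling supplies. The constant [c] depends on neither [t] nor [x]; it is not
    identified here with the mean of [u] under [mu]. *)
Hypothesis ergodic : forall (u : T -> R) (M : R),
  measurable_fun setT u -> 0 < M -> (forall x, `|u x| <= M) ->
  exists c, forall (t : R) x, 0 <= t ->
    `|\int[K t x]_y u y - c| <= M * (C * expR (- beta * t) * phi x).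

Local Notation energy u t := (\int[mu]_x ((\int[K t x]_y u y) ^+ 2)).

Lemma semigroup_comp u (s t : R) x : bounded_measurable u -> 0 <= s -> 0 <= t ->
  \int[K (s + t) x]_y u y = \int[K s x]_y \int[K t y]_z u z.
Proof.
move=> bu s0 t0; apply: (bounded_integral_mixture (mK t)) => // B mB.
exact: chapman.
Qed.

Lemma semigroup_invariant u (t : R) : bounded_measurable u -> 0 <= t ->
  \int[mu]_x \int[K t x]_y u y = \int[mu]_x u x.
Proof.
move=> bu t0; apply/esym/(bounded_integral_mixture (mK t)) => // B mB.
by apply: reversible_invariant => // A1 A2; exact: rev.
Qed.

(** Self-adjointness moves one of the two factors [T_t] onto the other, and the semigroup property
    merges them into [T_2t]. *)
Lemma energyE u (t : R) : bounded_measurable u -> 0 <= t ->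
  energy u t = \int[mu]_x (u x * \int[K (t + t) x]_y u y).
Proof.
move=> bu t0; under [RHS]eq_Rintegral do rewrite semigroup_comp//.
have bTu := bounded_measurable_kernel (mK t) bu.
rewrite (bounded_integral_reversible (mK t) (fun A B => @rev t A B t0) bu bTu).
by apply: eq_Rintegral => x _; rewrite expr2.
Qed.

Lemma energy_ge0 u t : 0 <= energy u t.
Proof. by apply: Rintegral_ge0 => x _; exact: sqr_ge0. Qed.

(** Cauchy-Schwarz applied to the inner product of [u] and [T_2t u] in [energyE]. *)
Lemma energy_sqr_le u (t : R) : bounded_measurable u -> 0 <= t ->
  energy u t ^+ 2 <= (\int[mu]_x (u x ^+ 2)) * energy u (t + t).
Proof.
move=> bu t0; rewrite energyE//.
by apply: bounded_cauchy_schwarz => //;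
  exact: (bounded_measurable_kernel (mK (t + t)) bu).
Qed.

(** One factor of [(T_t u) ^+ 2] is bounded by a constant and only the other by the ergodic
    estimate, because [phi] is assumed integrable but not square integrable. *)
Lemma energy_le u : bounded_measurable u -> \int[mu]_x u x = 0 ->
  exists D, forall t, 0 <= t -> energy u t <= D * expR (- beta * t).
Proof.
move=> bu u0; case: (bu) => mu_ [M uM].
(* [ergodic] asks for a strictly positive bound, and [M] may be zero. *)
have M'0 : 0 < `|M| + 1 by rewrite ltr_pwDr.
have uM' x : `|u x| <= `|M| + 1.
  by rewrite (le_trans (uM x))// (le_trans (ler_norm _))// lerDl.
move: M'0 uM'; set M' := `|M| + 1 => M'0 uM'.
have [c cP] := ergodic mu_ M'0 uM'.
set Phi := \int[mu]_x phi x.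
(* By invariance [T_t u] is centered like [u], so the mean of [T_t u - c] is [- c]; the ergodic
   estimate is integrated against [mu]. *)
have c_le t : 0 <= t -> `|c| <= M' * C * expR (- beta * t) * Phi.
  move=> t0; have bTu := bounded_measurable_kernel (mK t) bu.
  have bTuc := bounded_measurableB bTu (bounded_measurable_cst T c).
  have -> : `|c| = `|\int[mu]_x (\int[K t x]_y u y - c)%R|.
    rewrite bounded_RintegralB//; last exact: bounded_measurable_cst.
    by rewrite probability_Rintegral_cst semigroup_invariant// u0 sub0r normrN.
  apply: le_trans (le_normr_Rintegral _ _) _ => //.
    exact: bounded_measurable_integrable.
  rewrite -RintegralZl//; apply: le_Rintegral => //.
  - exact/bounded_measurable_integrable/bounded_measurable_norm.
  - exact: (integrableZl measurableT _ phi_int).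
  - by move=> x _; have := cP t x t0; rewrite !mulrA.
(* One [Phi] comes from integrating the bound on [T_t u - c], the other from the bound on [c]. *)
exists (M' * (M' * C * (Phi + Phi))) => t t0.
have bTu := bounded_measurable_kernel (mK t) bu.
set G := M' * C * expR (- beta * t).
have G0 : 0 <= G by rewrite !mulr_ge0// ?expR_ge0// ltW.
have iphi : mu.-integrable setT (EFin \o (fun x => G * phi x)).
  exact: (integrableZl measurableT _ phi_int).
have icst : mu.-integrable setT (EFin \o (fun=> G * Phi)).
  exact/bounded_measurable_integrable/bounded_measurable_cst.
have iGphi : mu.-integrable setT (EFin \o (fun x => G * phi x + G * Phi)).
  exact: (integrableD measurableT iphi icst).
have -> : M' * (M' * C * (Phi + Phi)) * expR (- beta * t) =
          \int[mu]_x (M' * (G * phi x + G * Phi)).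
  rewrite RintegralZl// RintegralD// RintegralZl// probability_Rintegral_cst.
  rewrite -/Phi /G.
  by ring.
apply: le_Rintegral => //.
- exact/bounded_measurable_integrable/bounded_measurable_sqr.
- exact: (integrableZl measurableT _ iGphi).
- move=> x _; rewrite -[leLHS]ger0_norm ?sqr_ge0// expr2 normrM.
  have TuM : `|\int[K t x]_y u y| <= M' by exact: bounded_normr_Rintegral.
  apply: ler_pM => //.
  have := cP t x t0; have := c_le t t0.
  rewrite -[X in _ -> _ -> `|X| <= _](subrK c) => h1 h2.
  apply: le_trans (ler_normD _ _) _; rewrite lerD//.
  by move: h2; rewrite !mulrA.
Qed.

(** The constant [D] of [energy_le] depends on the supremum of [u]; doubling replaces it by the
    squared L_2 norm, which makes an extension to unbounded functions possible. *)
Lemma bounded_contraction u (t : R) :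
  bounded_measurable u -> \int[mu]_x u x = 0 -> 0 <= t ->
  energy u t <= (\int[mu]_x (u x ^+ 2)) * expR (- beta * t).
Proof.
move=> bu u0 t0; have [D DP] := energy_le bu u0.
apply: (doubling_decay (a := fun t => energy u t) (D := D)) => //.
- by apply: Rintegral_ge0 => x _; exact: sqr_ge0.
- by move=> s _; exact: energy_ge0.
- by move=> s s0; exact: energy_sqr_le.
Qed.

(** Truncating a centered function can destroy centering, so a version with an error term in the
    mean is needed. It follows from the centered case for [u - m]. *)
Lemma bounded_contraction_mean u (t : R) : bounded_measurable u -> 0 <= t ->
  energy u t <=
  (\int[mu]_x (u x ^+ 2)) * expR (- beta * t) + (\int[mu]_x u x) ^+ 2.
Proof.
move=> bu t0; set m := \int[mu]_x u x.
have bm := bounded_measurable_cst T m.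
pose v x := u x - m.
have bv : bounded_measurable v by exact: bounded_measurableB.
have v0 : \int[mu]_x v x = 0.
  by rewrite bounded_RintegralB// probability_Rintegral_cst subrr.
have sqrB (w : T -> R) : bounded_measurable w -> \int[mu]_x w x = m ->
    \int[mu]_x ((w x - m) ^+ 2) = \int[mu]_x (w x ^+ 2) - m ^+ 2.
  move=> bw wm.
  have bw2 := bounded_measurable_sqr bw.
  have bmw := bounded_measurableZ (- 2 * m) bw.
  have bm2 := bounded_measurable_cst T (m ^+ 2).
  transitivity (\int[mu]_x (w x ^+ 2 + (- 2 * m * w x + m ^+ 2))).
    by apply: eq_Rintegral => x _; ring.
  rewrite bounded_RintegralD//; last exact: bounded_measurableD.
  rewrite bounded_RintegralD// bounded_RintegralZ//.
  by rewrite probability_Rintegral_cst wm; ring.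
have bTu := bounded_measurable_kernel (mK t) bu.
have := bounded_contraction bv v0 t0.
under eq_Rintegral do rewrite bounded_RintegralB// probability_Rintegral_cst.
(* The right side still contains [- m ^+ 2 * expR (- beta * t)], which is nonpositive and is
   dropped. *)
rewrite !sqrB// ?semigroup_invariant// mulrBl lerBlDr => /le_trans; apply.
have := mulr_ge0 (sqr_ge0 m) (expR_ge0 (- beta * t)).
lra.
Qed.

End ReversibleSemigroup.

(** * From bounded functions to L_2 *)

Section Clip.
Context (R : realType).
Implicit Types (a r : R).

Definition clip a r := Num.max (- a) (Num.min r a).

Lemma clip_id a r : `|r| <= a -> clip a r = r.
Proof.
rewrite ler_norml /clip => /andP[ar ra].
by rewrite (min_idPl ra) (max_idPr ar).
Qed.

Lemma clip_le a r : 0 <= a -> `|clip a r| <= a.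
Proof.
move=> a0; rewrite ler_norml /clip le_max lexx/= ge_max ge_min lexx orbT andbT.
by rewrite (le_trans _ a0)// oppr_le0.
Qed.

Lemma clip_le_norm a r : 0 <= a -> `|clip a r| <= `|r|.
Proof.
move=> a0; have [ra|ar] := leP `|r| a; first by rewrite clip_id.
exact: le_trans (clip_le r a0) (ltW ar).
Qed.

Lemma cvg_clip r : clip n%:R r @[n --> \oo] --> r.
Proof.
apply: cvg_near_cst; near=> n; apply/eqP.
rewrite clip_id//; near: n; exact: nbhs_infty_ger.
Unshelve. all: by end_near. Qed.

End Clip.

Section AeFatou.
Context d (T : measurableType d) (R : realType).
Variable mu : {measure set T -> \bar R}.
Local Open Scope ereal_scope.

(** Fatou's lemma on the complement of the null set [N] where convergence may fail. *)
Lemma ge0_integral_le_cvg (f_ : (T -> \bar R)^nat) (f : T -> \bar R)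
    (w : (\bar R)^nat) l :
  (forall n, measurable_fun setT (f_ n)) -> (forall n x, 0 <= f_ n x) ->
  measurable_fun setT f -> (forall x, 0 <= f x) ->
  {ae mu, forall x, f_ n x @[n --> \oo] --> f x} ->
  (forall n, \int[mu]_x f_ n x <= w n) -> w n @[n --> \oo] --> l ->
  \int[mu]_x f x <= l.
Proof.
move=> mf_ f_0 mf f0 [N [mN N0 fN]] f_w wl.
have mD : measurable (setT `\` N) by exact: measurableD.
rewrite (ge0_negligible_integral _ _ _ _ N0)//.
have -> : \int[mu]_(x in setT `\` N) f x =
          \int[mu]_(x in setT `\` N) limn_einf (f_ ^~ x).
  apply: eq_integral => x; rewrite inE => -[_ xN].
  have fx : f_ n x @[n --> \oo] --> f x by apply: contrapT => h; exact/xN/fN.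
  by have [->] := cvg_limn_einf_sup fx.
apply: le_trans; first apply: fatou => //.
  by move=> n; exact: measurable_funTS.
(* The lower limit is the limit of the infima over tails, and each infimum is at most its first
   term, hence at most [w n]. *)
rewrite limn_einf_lim -(cvg_lim _ wl)//; apply: lee_lim.
- exact: is_cvg_einfs.
- by apply/cvg_ex; exists l.
apply: nearW => n; apply: le_trans (f_w n).
apply: le_trans (ereal_inf_lbound _) _; first by exists n => /=.
by apply: ge0_subset_integral.
Qed.

End AeFatou.

Section L2Contraction.
Context d (T : measurableType d) (R : realType).
Variables (mu : probability T R) (k : T -> probability T R) (q : R).
Hypothesis mk : forall B, measurable B -> measurable_fun [set: T] (k ^~ B).
Hypothesis inv : forall B, measurable B -> (mu B = \int[mu]_x k x B)%E.
Hypothesis q_ge0 : 0 <= q.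
Hypothesis contraction : forall u, bounded_measurable u ->
  \int[mu]_x ((\int[k x]_y u y) ^+ 2) <=
  q * (\int[mu]_x (u x ^+ 2)) + (\int[mu]_x u x) ^+ 2.

Lemma measurable_clip (u : T -> R) a : measurable_fun setT u ->
  measurable_fun setT (clip a \o u).
Proof.
by move=> mu_; apply: measurable_maxr => //; exact: measurable_minr.
Qed.

Lemma bounded_measurable_clip (u : T -> R) a :
  0 <= a -> measurable_fun setT u -> bounded_measurable (clip a \o u).
Proof.
move=> a0 mu_; split; first exact: measurable_clip.
by exists a => x; exact: clip_le.
Qed.

(** Used both with [nu] equal to [mu], for the means, and with [nu] equal to [k x], for the kernel
    integrals. *)
Lemma cvg_integral_clip (nu : probability T R) (u : T -> R) :
  nu.-integrable setT (EFin \o u) ->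
  (\int[nu]_x clip n%:R (u x)) @[n --> \oo] --> \int[nu]_x u x.
Proof.
move=> iu; have mu_ : measurable_fun setT u.
  by apply/measurable_EFinP; case/integrableP : iu.
have [] := @dominated_convergence _ _ _ nu setT measurableT
  (fun n x => (clip n%:R (u x))%:E) (EFin \o u) (abse \o (EFin \o u)).
- by move=> n; apply/measurable_EFinP; exact: measurable_clip.
- exact/measurable_EFinP.
- by apply/aeW => x _; apply: cvg_EFin; [exact: nearW|exact: cvg_clip].
- exact: integrable_abse.
- by apply/aeW => x n _ /=; rewrite lee_fin clip_le_norm.
move=> _ _ h; apply: fine_cvg; rewrite fineK//.
exact: integrable_fin_num.
Qed.

(** By invariance, averaging the integral of [|u|] under [k x] over [mu] gives the finite integral
    of [|u|] under [mu], so the inner integral is finite almost everywhere. *)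
Lemma ae_integrable_kernel (u : T -> R) : mu.-integrable setT (EFin \o u) ->
  {ae mu, forall x, (k x).-integrable setT (EFin \o u)}.
Proof.
move=> /integrableP[mu_ ioo].
have mau : measurable_fun setT (fun x => `|(EFin \o u) x|)%E.
  exact: measurableT_comp.
have : mu.-integrable setT (fun x => \int[k x]_y `|(EFin \o u) y|)%E.
  apply/integrableP; split; first exact: measurable_fun_integral_kernel.
  under eq_integral do rewrite gee0_abs ?integral_ge0//.
  by rewrite -(ge0_integral_mixture mk inv).
move=> /(integrable_ae measurableT); apply: filterS => x /(_ Logic.I) xfin.
by apply/integrableP; split => //; rewrite -ge0_fin_numE ?integral_ge0.
Qed.

Lemma L2_contraction (u : T -> R) : measurable_fun setT u ->
  (\int[mu]_x (u x ^+ 2)%:E < +oo)%E -> \int[mu]_x u x = 0 ->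
  (\int[mu]_x ((\int[k x]_y u y) ^+ 2)%:E <= q%:E * \int[mu]_x (u x ^+ 2)%:E)%E.
Proof.
move=> mu_ u2oo u0.
have mu2 : measurable_fun setT (fun x => (u x ^+ 2)%:E).
  by apply/measurable_EFinP; exact: measurable_funX.
have iu2 : mu.-integrable setT (EFin \o (fun x => u x ^+ 2)).
  apply/integrableP; split => //.
  by under eq_integral do rewrite /= ger0_norm ?sqr_ge0//.
have iu : mu.-integrable setT (EFin \o u).
  have i1 :=
    bounded_measurable_integrable mu (bounded_measurable_cst T (1 : R)).
  (* L_2 embeds in L_1 through [|u| <= 1 + u ^+ 2]. *)
  apply: le_integrable (integrableD measurableT i1 iu2) => //.
    exact/measurable_EFinP.
  move=> x _ /=; rewrite lee_fin [leRHS]ger0_norm ?addr_ge0 ?sqr_ge0//.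
  rewrite -(real_normK (num_real (u x))).
  have := sqr_ge0 (`|u x| - 1); have := normr_ge0 (u x); rewrite sqrrB1.
  lra.
pose U n := clip n%:R \o u.
have bU n : bounded_measurable (U n) by exact: bounded_measurable_clip.
pose w n : \bar R :=
  ((q * \int[mu]_x (u x ^+ 2) + (\int[mu]_x U n x) ^+ 2)%R)%:E.
have w_cvg : w n @[n --> \oo] --> (q%:E * \int[mu]_x (u x ^+ 2)%:E)%E.
  (* The added [0 ^+ 2] is the squared mean of [u], the limit of the squared means of its
     truncations. *)
  have -> : (q%:E * \int[mu]_x (u x ^+ 2)%:E)%E =
      (q * \int[mu]_x (u x ^+ 2) + 0 ^+ 2)%:E.
    by rewrite expr0n addr0 EFinM fineK// integrable_fin_num.
  apply: cvg_EFin; first exact: nearW.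
  apply: cvgD; first exact: cvg_cst.
  rewrite expr2 -u0; under eq_cvg do rewrite /= expr2.
  by apply: cvgM; exact: cvg_integral_clip.
apply: (ge0_integral_le_cvg
  (f_ := fun n x => ((\int[k x]_y U n y) ^+ 2)%:E)) w_cvg.
- move=> n; apply/measurable_EFinP/measurable_funX.
  by apply: measurable_Rintegral_kernel => //; case: (bU n).
- by move=> n x; rewrite lee_fin sqr_ge0.
- exact/measurable_EFinP/measurable_funX/measurable_Rintegral_kernel.
- by move=> x; rewrite lee_fin sqr_ge0.
- apply: filterS (ae_integrable_kernel iu) => x ix.
  apply: cvg_EFin; first exact: nearW.
  rewrite expr2; under eq_cvg do rewrite /= expr2.
  by apply: cvgM; exact: cvg_integral_clip.
move=> n; rewrite -EFin_Rintegral; last first.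
  exact/bounded_measurable_sqr/bounded_measurable_kernel.
rewrite lee_fin (le_trans (contraction (bU n)))// lerD2r ler_wpM2l//.
apply: le_Rintegral => //.
  exact/bounded_measurable_integrable/bounded_measurable_sqr.
move=> x _; rewrite -(real_normK (num_real (u x))).
rewrite -(real_normK (num_real (U n x))).
by rewrite ler_pXn2r ?nnegrE// clip_le_norm.
Qed.

End L2Contraction.

(** * The transition function of the process *)

Section Transition.
Context (R : realType) (E : pmetricType R) (d : measure_display).
Context (Omega : measurableType d).
Variables (X : R -> {mfun Omega >-> borel E}) (P : R.-pker (borel E) ~> Omega).

Lemma measurable_transition t B : measurable B ->
  measurable_fun [set: borel E] ((transition X P t) ^~ B).
Proof.
move=> mB; apply: measurable_kernel.
by rewrite -[X in measurable X]setTI; exact: (measurable_funPT (X t)).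
Qed.

Lemma history_sigma_algebra t : sigma_algebra setT (history X t).
Proof. exact: smallest_sigma_algebra. Qed.

(* The strong Markov property at the constant stopping time [s]. *)
Lemma chapman_kolmogorov (s t : R) x B : strong_markov_property X P ->
  0 <= s -> 0 <= t -> measurable B ->
  (transition X P (s + t) x B =
   \int[transition X P s x]_y transition X P t y B)%E.
Proof.
move=> sm s0 t0 mB.
have histT r : history X r setT.
  have [h0 hC _] := history_sigma_algebra r; rewrite -(setD0 setT); exact: hC.
have hist0 r : history X r set0 by have [] := history_sigma_algebra r.
have hist_le r : history X r [set w : Omega | (s%:E <= r%:E)%E].
  have [sr|rs] := leP s%:E r%:E.
    by rewrite (_ : mkset _ = setT)//; apply/seteqP; split.
  by rewrite (_ : mkset _ = set0)//; apply/seteqP; split.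
have st : stopping_time X (fun=> s%:E).
  by split => [w|r _]; [rewrite lee_fin|exact: hist_le].
have bs : before_stopping X (fun=> s%:E) setT.
  by split => // r _; rewrite setTI.
have := sm x _ st _ bs t B t0 mB.
have -> : [set w : Omega | (s%:E < +oo)%E] = setT.
  by apply/seteqP; split => // w _ /=; exact: ltry.
rewrite /= !setTI => E1; apply: etrans E1 _; apply/esym.
rewrite ge0_integral_pushforward//; exact: measurable_transition.
Qed.

End Transition.

(** * Detailed balance from time reversal *)

Section Reversibility.
Context (R : realType) (E : pmetricType R) (d : measure_display).
Context (Omega : measurableType d).
Variables (X : R -> {mfun Omega >-> borel E}) (P : R.-pker (borel E) ~> Omega).

Lemma measurable_borel_set1 (x : borel E) : measurable [set x].
Proof.
rewrite -(setCK [set x]); apply: measurableC; apply: sub_sigma_algebra.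
apply/closed_openC/accessible_closed_set1/hausdorff_accessible.
exact: (@metric_hausdorff R E).
Qed.

Lemma measurable_position t B : measurable B -> measurable (X t @^-1` B).
Proof.
move=> mB; rewrite -[X in measurable X]setTI.
exact: (measurable_funPT (X t)).
Qed.

Hypothesis start : forall x : borel E, P x (X 0 @^-1` [set x]) = 1%E.

Lemma start_null (x : borel E) W : measurable W ->
  W `<=` ~` (X 0 @^-1` [set x]) -> P x W = 0%E.
Proof.
move=> mW WC; have mx := measurable_position 0 (measurable_borel_set1 x).
have WT : P x (W `|` X 0 @^-1` [set x]) = (P x W + 1)%E.
  rewrite measureU//; last exact/disjoints_subset.
  by congr (_ + _)%E; exact: start.
have : (P x W + 1 <= 0 + 1)%E.
  have PT : P x setT = 1%E by exact: prob_kernel.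
  rewrite -WT add0e -PT le_measure// inE//; exact: measurableU.
by rewrite leeD2rE// measure_le0 => /eqP.
Qed.

(** Under [P x] the initial position is almost surely [x], so a condition on [X 0] acts as an
    indicator of [x]. *)
Lemma start_at (x : borel E) A W : measurable A -> measurable W ->
  P x (X 0 @^-1` A `&` W) = if x \in A then P x W else 0%E.
Proof.
move=> mA mW; have mXA := measurable_position 0 mA.
case: ifPn => [|xA].
  rewrite inE => xA.
  rewrite [RHS](measureDI (P x) mW mXA) setIC.
  rewrite [X in (X + _)%E](_ : _ = 0%E) ?add0e//.
  apply: start_null; first exact: measurableD.
  by move=> w [_ XwA] Xwx; apply: XwA; rewrite /= Xwx.
apply: start_null; first exact: measurableI.
by move=> w [/= XwA _] Xwx; move/negP: xA; apply; apply/mem_set; rewrite -Xwx.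
Qed.

Lemma time_reversible_transition (pi : probability (borel E) R) t A B :
  time_reversible X P pi -> 0 <= t -> measurable A -> measurable B ->
  (\int[pi]_(x in A) transition X P t x B =
   \int[pi]_(x in B) transition X P t x A)%E.
Proof.
move=> rev t0 mA mB.
(* Reading a path backwards on [[0, t]] exchanges the conditions at the two ends of this
   cylinder. *)
pose S := [set f : R -> E | A (f 0)] `&` [set f | B (f t)].
have mS : path_events [set s | 0 <= s <= t] S.
  have gen (s : R) (D : set (borel E)) : 0 <= s <= t -> measurable D ->
      path_events [set s | 0 <= s <= t] [set f : R -> E | D (f s)].
    by move=> st mD; apply: sub_sigma_algebra; exists s, D.
  apply: (@measurableI _ (g_sigma_algebraType _)); apply: gen => //.
  - by rewrite lexx.
  - by rewrite t0 lexx.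
have lhs x : P x [set w | S (fun s => X s w)] =
    if x \in A then transition X P t x B else 0%E.
  by rewrite -start_at//; exact: measurable_position.
have rhs x : P x [set w | S (fun s => X (t - s) w)] =
    if x \in B then transition X P t x A else 0%E.
  rewrite -start_at//; last exact: measurable_position.
  by rewrite /S /= subr0 subrr setIC.
have h := rev t S t0 mS.
rewrite [LHS]integral_mkcond [RHS]integral_mkcond.
transitivity (\int[pi]_x P x [set w | S (fun s => X s w)])%E.
  by apply: eq_integral => x _; rewrite lhs patchE.
by rewrite -h; apply: eq_integral => x _; rewrite rhs patchE.
Qed.

End Reversibility.

(** * The complex L_2 norm *)

Section ComplexNorm.
Context (R : realType) (d : measure_display) (T : measurableType d).
Variable mu : {measure set T -> \bar R}.
Implicit Types f : T -> R[i].

Lemma norm2E f : norm2 mu f =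
  poweR (\int[mu]_x (complex.Re (f x) ^+ 2 + complex.Im (f x) ^+ 2)%:E)%E 2^-1.
Proof.
rewrite /norm2 unlock; congr poweR.
apply: eq_integral => x _.
rewrite abse_EFin /= powR_mulrn//; congr EFin.
case: (f x) => a b /=; rewrite ger0_norm ?sqrtr_ge0// sqr_sqrtr//.
by rewrite addr_ge0// sqr_ge0.
Qed.

Lemma L2_Re_Im f : L2 mu f ->
  [/\ measurable_fun setT (fun x => complex.Re (f x)),
      measurable_fun setT (fun x => complex.Im (f x)),
      (\int[mu]_x ((complex.Re (f x)) ^+ 2)%:E < +oo)%E &
      (\int[mu]_x ((complex.Im (f x)) ^+ 2)%:E < +oo)%E].
Proof.
move=> [[mRe mIm]]; rewrite norm2E => foo.
have mRe2 : measurable_fun setT (fun x => ((complex.Re (f x)) ^+ 2)%:E).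
  by apply/measurable_EFinP; exact: measurable_funX.
have mIm2 : measurable_fun setT (fun x => ((complex.Im (f x)) ^+ 2)%:E).
  by apply/measurable_EFinP; exact: measurable_funX.
have : (\int[mu]_x (complex.Re (f x) ^+ 2 + complex.Im (f x) ^+ 2)%:E < +oo)%E.
  rewrite ltNge leye_eq; apply/negP => /eqP fooE.
  by move: foo; rewrite fooE poweRyr ?ltxx// invr_eq0 pnatr_eq0.
under eq_integral do rewrite EFinD.
rewrite ge0_integralD//; last 2 first.
- by move=> x _; rewrite lee_fin sqr_ge0.
- by move=> x _; rewrite lee_fin sqr_ge0.
move=> h; split => //; apply: le_lt_trans h.
- by rewrite leeDl// integral_ge0// => x _; rewrite lee_fin sqr_ge0.
- by rewrite leeDr// integral_ge0// => x _; rewrite lee_fin sqr_ge0.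
Qed.

End ComplexNorm.

(** * Detailed balance from self-adjointness *)

Section SelfAdjoint.
Context (R : realType) (E : pmetricType R) (d : measure_display).
Context (Omega : measurableType d).
Variables (X : R -> {mfun Omega >-> borel E}) (P : R.-pker (borel E) ~> Omega).
Local Open Scope complex_scope.

(** Self-adjointness is tested on the indicators of [A] and [B], which are bounded and hence in
    L_2. *)
Lemma self_adjoint_transition (pi : probability (borel E) R) t A B :
  self_adjoint_semigroup X P pi -> 0 <= t -> measurable A -> measurable B ->
  (\int[pi]_(x in A) transition X P t x B =
   \int[pi]_(x in B) transition X P t x A)%E.
Proof.
move=> adj t0 mA mB.
pose ind (D : set (borel E)) (x : borel E) : R[i] := (\1_D x : R)%:C.
have L2ind D : measurable D -> L2 pi (ind D).
  move=> mD; split.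
    by split; [exact: measurable_indic|exact: measurable_cst].
  rewrite norm2E poweR_lty//.
  apply: (@le_lt_trans _ _ (\int[pi]_x 1)%E); last first.
    by rewrite integral_cst// mul1e [X in (X < _)%E]probability_setT ltry.
  apply: ge0_le_integral => //.
  - by move=> x _; rewrite lee_fin addr_ge0 ?sqr_ge0.
  - apply/measurable_EFinP; apply: measurable_funD; apply: measurable_funX;
      [exact: measurable_indic|exact: measurable_cst].
  - move=> x _; rewrite lee_fin /= expr0n addr0 indicE.
    by case: (x \in D); rewrite ?expr1n// expr0n ler01.
have bind D : measurable D -> bounded_measurable (\1_D : borel E -> R).
  move=> mD; split; first exact: measurable_indic.
  by exists 1 => x; rewrite indicE; case: (x \in D); rewrite ?normr1 ?normr0.
have main D F : measurable D -> measurable F ->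
   (\int[pi]_(x in D) transition X P t x F)%E =
   (complex.Re (inner2 pi (semigroup X P t (ind F)) (ind D)))%:E.
  move=> mD mF.
  have bK : bounded_measurable
      (fun x => \int[transition X P t x]_y (\1_F y : R)).
    apply: (bounded_measurable_kernel _ (bind _ mF)).
    exact: measurable_transition.
  transitivity
    (\int[pi]_x ((\int[transition X P t x]_y \1_F y) * \1_D x))%:E; last first.
    congr EFin; apply: eq_Rintegral => x _ /=.
    by rewrite /ind /= oppr0 mulr0 subr0.
  rewrite EFin_Rintegral; last exact: bounded_measurableM bK (bind _ mD).
  rewrite integral_mkcond; apply: eq_integral => x _; rewrite patchE indicE.
  case: ifPn => xD; last by rewrite mulr0.
  rewrite mulr1 /Rintegral integral_indic// setIT fineK//.
  exact: fin_num_measure.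
(* After the semigroup has moved to the other indicator, the two inner products have the same real
   part, because indicators have no imaginary part. *)
rewrite main// [RHS]main// adj//; [|exact: L2ind|exact: L2ind].
rewrite /inner2/=; congr EFin; apply: eq_Rintegral => x _ /=.
by rewrite /ind /= oppr0 mulr0 subr0 mul0r subr0 mulrC.
Qed.
End SelfAdjoint.

(** * From the coupling to an ergodic estimate *)

Section Coupling.
Context (R : realType) (E : pmetricType R) (d : measure_display).
Context (Omega : measurableType d).
Variables (X : R -> {mfun Omega >-> borel E}) (P : R.-pker (borel E) ~> Omega).

(** Equality of path laws is used only on cylinders at the single time [t], which identifies the law
    of [Z t] as [nu]. *)
Lemma has_law_from_marginal (mu : probability (borel E) R)
    (nu : probability (borel E) R) d' (Omega' : measurableType d')
    (P' : probability Omega' R) (Z : R -> {mfun Omega' >-> borel E}) (t : R)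
    (u : borel E -> R) :
  has_law_from X P mu P' Z -> 0 <= t ->
  (forall B, measurable B -> \int[mu]_x transition X P t x B = nu B)%E ->
  bounded_measurable u ->
  \int[P']_w u (Z t w) = \int[nu]_y u y.
Proof.
move=> law t0 nuE bu.
have mu_ : measurable_fun setT (EFin \o u) by apply/measurable_EFinP; case: bu.
have buZ : bounded_measurable (u \o Z t).
  case: bu => mu' [M uM]; split; first exact: measurableT_comp.
  by exists M => w; exact: uM.
congr fine.
rewrite -[LHS]/(\int[P']_(w in Z t @^-1` setT) ((EFin \o u) \o Z t) w)%E.
rewrite -integral_pushforward//; last first.
  exact: bounded_measurable_integrable.
apply: eq_measure_integral => B mB _.
apply: etrans (nuE B mB); apply: (law [set f | B (f t)]).
by apply: sub_sigma_algebra; exists t, B.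
Qed.

(* Here [g] need not be measurable, its integral being a supremum over the simple
   functions below it; the set {Z^1 <> Z^2} of a coupling may be nonmeasurable. *)
Lemma ge0_le_integralT d' (T : measurableType d')
    (mu : {measure set T -> \bar R}) (f g : T -> \bar R) :
  measurable_fun setT f ->
  (forall x, 0 <= f x)%E -> (forall x, f x <= g x)%E ->
  (\int[mu]_x f x <= \int[mu]_x g x)%E.
Proof.
move=> mf f0 fg; rewrite !ge0_integralTE//; last first.
  by move=> x; exact: le_trans (f0 x) (fg x).
apply: le_ereal_sup => _ [h hf <-]; exists h => // x.
exact: le_trans (hf x) (fg x).
Qed.

(** [T_t u x] and the mean of [u] under the invariant measure of the coupling are the expectations
    of [u (Z1 t)] and [u (Z2 t)]. The two values can differ only where the components differ, and
    there by at most [2 * M], which is at most [M] times the sum of the two values of [phi]. *)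
Lemma coupling_ergodic (phi : borel E -> R) beta :
  (forall x, 1 <= phi x) -> exponential_coupling X P phi beta ->
  exists2 C, 0 <= C & forall (u : borel E -> R) (M : R),
    measurable_fun setT u -> 0 < M -> (forall x, `|u x| <= M) ->
  exists c, forall (t : R) x, 0 <= t ->
    `|\int[transition X P t x]_y u y - c| <=
    M * (C * expR (- beta * t) * phi x).
Proof.
move=> phi1 [_ [C [pi [C0 inv cpl]]]]; exists C; first exact: ltW.
move=> u M mu_ M0 uM; exists (\int[pi]_y u y) => t x t0.
have [d' [ Omega' [P' [Z1 [Z2 [[law1 law2] Zle]]]]]] := cpl x.
have bu : bounded_measurable u by split => //; exists M.
have bZ (Z : R -> {mfun Omega' >-> borel E}) : bounded_measurable (u \o Z t).
  by split; [exact: measurableT_comp|exists M => w; exact: uM].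
rewrite -(has_law_from_marginal (mu := pi) (nu := pi) law2 t0)//; last first.
  by move=> B mB; exact: inv.
rewrite -(has_law_from_marginal (mu := dirac x) (nu := transition X P t x)
  law1 t0)//; last first.
  move=> B mB; rewrite integral_dirac//; last exact: measurable_transition.
  by rewrite diracT mul1e.
rewrite -bounded_RintegralB//; [|exact: bZ|exact: bZ].
pose D w := u (Z1 t w) - u (Z2 t w).
have bD : bounded_measurable D by apply: bounded_measurableB; exact: bZ.
have bnD := bounded_measurable_norm bD.
have bMD := bounded_measurableZ M^-1 bnD.
have iD := bounded_measurable_integrable P' bD.
apply: le_trans (le_normr_Rintegral _ iD) _ => //.
rewrite -ler_pdivrMl// -bounded_RintegralZ// -lee_fin EFin_Rintegral//.
(* The smaller function [M^-1 * |D|] is measurable even if the integrand of the coupling is not. *)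
apply: le_trans (Zle t t0); apply: ge0_le_integralT.
- by apply/measurable_EFinP; case: bMD.
- by move=> w; rewrite lee_fin mulr_ge0// invr_ge0 ltW.
move=> w; rewrite lee_fin indicE ler_pdivrMl//.
have [e|ne] := eqVneq (Z1 t w) (Z2 t w).
  rewrite /D e subrr normr0 mulr_ge0 ?(ltW M0)// mulr_ge0//.
  by rewrite addr_ge0// (le_trans ler01).
rewrite mem_set ?mulr1; last exact/eqP.
apply: le_trans (ler_normB _ _) _; rewrite mulrDr lerD//.
- by rewrite (le_trans (uM _))// ler_peMr// ltW.
- by rewrite (le_trans (uM _))// ler_peMr// ltW.
Qed.

End Coupling.

(** * The Poincare inequality *)

Theorem theorem3p3 (R : realType) (E : pmetricType R)
  (d : measure_display) (Omega : measurableType d)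
  (X : R -> {mfun Omega >-> borel E}) (P : R.-pker (borel E) ~> Omega)
  (phi : borel E -> R) (beta : R) (pi : probability (borel E) R)
  (lcE : locally_compact [set: E])
  (smX : strong_markov_process X P)
  (mphi : measurable_fun setT phi) (phi_ge1 : forall x, 1 <= phi x)
  (cX : exponential_coupling X P phi beta)
  (invpi : invariant_measure X P pi)
  (phiL1 : pi.-integrable setT (fun x => (phi x)%:E))
  (revX : time_reversible X P pi \/ self_adjoint_semigroup X P pi) :
  PI X P pi (beta / 2).
Proof.
have [start _ _ markov] := smX.
have [C C0 ergodic] := coupling_ergodic phi_ge1 cX.
have rev t A B : 0 <= t -> measurable A -> measurable B ->
    (\int[pi]_(x in A) transition X P t x B =
     \int[pi]_(x in B) transition X P t x A)%E.
  move=> t0 mA mB; case: revX => [rX|adj].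
    exact: time_reversible_transition.
  exact: self_adjoint_transition.
have mK t B : measurable B ->
    measurable_fun [set: borel E] ((transition X P t) ^~ B).
  exact: measurable_transition.
move=> t f t0 [L2f f0].
have [mRe mIm Reoo Imoo] := L2_Re_Im L2f.
have [Re0 Im0] :
    \int[pi]_x complex.Re (f x) = 0 /\ \int[pi]_x complex.Im (f x) = 0.
  by case: f0.
have contraction (u : borel E -> R) : measurable_fun setT u ->
    (\int[pi]_x (u x ^+ 2)%:E < +oo)%E -> \int[pi]_x u x = 0 ->
    (\int[pi]_x ((\int[transition X P t x]_y u y) ^+ 2)%:E <=
     (expR (- beta * t))%:E * \int[pi]_x (u x ^+ 2)%:E)%E.
  move=> mu_ u2 u0.
  (* Here the contraction factor [q] is [expR (- beta * t)]. *)
  apply: (L2_contraction (mK t) _ (expR_ge0 _) _ mu_ u2 u0).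
    by move=> B mB; rewrite invpi.
  move=> v bv; rewrite mulrC.
  apply: (bounded_contraction_mean mK _ rev C0 phiL1 ergodic bv t0).
  by move=> s r x B s0 r0 mB; exact: chapman_kolmogorov.
have split2 (u v : borel E -> R) :
    measurable_fun setT u -> measurable_fun setT v ->
    (\int[pi]_x (u x ^+ 2 + v x ^+ 2)%:E =
     \int[pi]_x (u x ^+ 2)%:E + \int[pi]_x (v x ^+ 2)%:E)%E.
  move=> mu_ mv; under eq_integral do rewrite EFinD.
  rewrite ge0_integralD// => [x _||x _|]; rewrite ?lee_fin ?sqr_ge0//.
  - exact/measurable_EFinP/measurable_funX.
  - exact/measurable_EFinP/measurable_funX.
(* The rate [beta] governs squared norms; taking the square root halves it. *)
have -> : expR (- (beta / 2) * t) = expR (- beta * t) `^ 2^-1.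
  by rewrite -expRM; congr expR; rewrite !mulNr mulrAC.
rewrite !norm2E -poweR_EFin -poweRM ?lee_fin ?expR_ge0//; last first.
  by apply: integral_ge0 => x _; rewrite lee_fin addr_ge0 ?sqr_ge0.
apply: gt0_ler_poweR => //.
- rewrite in_itv/= leey andbT; apply: integral_ge0 => x _.
  by rewrite lee_fin addr_ge0 ?sqr_ge0.
- rewrite in_itv/= leey andbT mule_ge0 ?lee_fin ?expR_ge0//.
  by apply: integral_ge0 => x _; rewrite lee_fin addr_ge0 ?sqr_ge0.
(* The real and imaginary parts of [T_t f] are the kernel integrals of those of [f], so the real
   contraction applies to each and the squared norms add. *)
rewrite /semigroup /cintegral/=.
rewrite !split2//; try exact: (measurable_Rintegral_kernel (mK t)).
rewrite ge0_muleDr; first by apply: leeD; exact: contraction.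
- by apply: integral_ge0 => x _; rewrite lee_fin sqr_ge0.
- by apply: integral_ge0 => x _; rewrite lee_fin sqr_ge0.
Qed.
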